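(* Let $m,n\ge1$ be integers and let $P\in\mathbb{R}$ be such that $n^2<P\le m^2$. Then there exist $0<E_1\le E_2<\infty$ such that: (i) if $0<E_{\Theta_m}<E_1$ then $\Theta_m$ is linearly unstable with respect to $\Theta_n$; (ii) if $E_{\Theta_m}>E_2$ then $\Theta_m$ is linearly stable with respect to $\Theta_n$.
   Context: $\Theta_m$ denotes any solution $\Theta_m:\mathbb{R}\to\mathbb{R}$ of the Duffing equation $$\ddot{\Theta}_m(t)+m^2(m^2-P)\Theta_m(t)+m^4\Theta_m(t)^3=0 ,$$ and its (constant) energy is $$E_{\Theta_m}=\frac{\dot{\Theta}_m(0)^2}{2}+\frac{m^2(m^2-P)}{2}\Theta_m(0)^2+\frac{m^4}{4}\Theta_m(0)^4 .$$ The assertions hold for every solution $\Theta_m$ whose energy lies in the indicated range. $\Theta_m$ is said to be linearly stable (unstable) with respect to the $n$-th mode $\Theta_n$ if $\xi\equiv0$ is a stable (unstable) solution of the Hill equation $$\ddot{\xi}+a(t)\xi=0,\qquad a(t)=n^2(n^2-P)+m^2n^2\Theta_m(t)^2 ;$$ stability of $\xi\equiv0$ is equivalent to all solutions $\xi$ being bounded on $\mathbb{R}$, and unstable means not stable. *)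

(* Defs.v *)
From Stdlib Require Import Reals.
From Coquelicot Require Import Coquelicot.
Open Scope R_scope.

(* [ex_derive_n f 2] alone only speaks about the totalized [Derive f], so
   first-order differentiability is required separately. *)
Definition twice_derivable (f : R -> R) : Prop :=
  forall t, ex_derive f t /\ ex_derive_n f 2 t.

Definition duffing_solution (m : nat) (P : R) (Theta : R -> R) : Prop :=
  twice_derivable Theta /\
  forall t,
    Derive_n Theta 2 t + INR m ^ 2 * (INR m ^ 2 - P) * Theta t
      + INR m ^ 4 * Theta t ^ 3 = 0.

Definition energy (m : nat) (P : R) (Theta : R -> R) : R :=
  Derive Theta 0 ^ 2 / 2
  + INR m ^ 2 * (INR m ^ 2 - P) / 2 * Theta 0 ^ 2
  + INR m ^ 4 / 4 * Theta 0 ^ 4.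

Definition hill_solution (a xi : R -> R) : Prop :=
  twice_derivable xi /\ forall t, Derive_n xi 2 t + a t * xi t = 0.

(* Lyapunov stability, in the phase plane (xi, xi') and for every initial time,
   of the zero solution of xi'' + a xi = 0. When [a] is continuous and periodic
   it is equivalent to boundedness on the whole line of all solutions xi. *)
Definition zero_stable (a : R -> R) : Prop :=
  forall t0 eps, 0 < eps ->
  exists delta, 0 < delta /\
    forall xi, hill_solution a xi ->
      Rabs (xi t0) < delta -> Rabs (Derive xi t0) < delta ->
      forall t, t0 <= t -> Rabs (xi t) < eps /\ Rabs (Derive xi t) < eps.

Definition hill_coefficient (m n : nat) (P : R) (Theta : R -> R) (t : R) : R :=
  INR n ^ 2 * (INR n ^ 2 - P) + INR m ^ 2 * INR n ^ 2 * Theta t ^ 2.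

Definition linearly_stable (m n : nat) (P : R) (Theta : R -> R) : Prop :=
  zero_stable (hill_coefficient m n P Theta).

Definition linearly_unstable (m n : nat) (P : R) (Theta : R -> R) : Prop :=
  ~ zero_stable (hill_coefficient m n P Theta).

(* Main.v *)
(* Write the Duffing equation as Theta'' + (A + B Theta^2) Theta = 0 with
   A = m^2 (m^2 - P) >= 0 and B = m^4, and the Hill coefficient as
   a = D Theta^2 - K with D = m^2 n^2 <= B and K = n^2 (P - n^2) > 0.

   For small energy a <= 0, so solutions of the Hill equation with positive
   initial data are convex and grow at least linearly.

   For large energy let s0 be a zero of Theta and s1 the next critical point; say
   Theta' > 0 on [s0, s1). Then a is even about s0 and about s1. Let c, s be the
   cosine- and sine-like solutions at s0. The monodromy over 2 (s1 - s0) preserves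
   the quadratic form - c(s1) c'(s1) xi^2 + s(s1) s'(s1) xi'^2, which is positive
   definite because of three Sturm comparisons on [s0, s1]:
   - s' > 0, comparing s with Theta (a < A + B Theta^2);
   - c > 0, comparing c with Theta' (a < A + 3 B Theta^2);
   - c'(s1) < 0, comparing c with g = 1 + (K / 2E) Theta^2, for which
     g'' + a g > 0 when the energy E is large. *)

Require Import Defs.
From Stdlib Require Import Reals Factorial Lra Lia.
From Coquelicot Require Import Coquelicot.
Open Scope R_scope.

(** * Differentiation rules and a tactic that chains them *)

Lemma is_derive_eq (f : R -> R) (x l l' : R) :
  is_derive f x l -> l = l' -> is_derive f x l'.
Proof. now intros H <-. Qed.

Lemma is_derive_Rmult (f g : R -> R) (x df dg : R) :
  is_derive f x df -> is_derive g x dg ->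
  is_derive (fun t => f t * g t) x (df * g x + f x * dg).
Proof.
  intros Hf Hg. apply (is_derive_mult f g x df dg); auto. intros; apply Rmult_comm.
Qed.

Lemma is_derive_Rplus (f g : R -> R) (x df dg : R) :
  is_derive f x df -> is_derive g x dg -> is_derive (fun t => f t + g t) x (df + dg).
Proof. intros; now apply (is_derive_plus f g). Qed.

Lemma is_derive_Rminus (f g : R -> R) (x df dg : R) :
  is_derive f x df -> is_derive g x dg -> is_derive (fun t => f t - g t) x (df - dg).
Proof. intros; now apply (is_derive_minus f g). Qed.

Lemma is_derive_Ropp (f : R -> R) (x df : R) :
  is_derive f x df -> is_derive (fun t => - f t) x (- df).
Proof. intros; now apply (is_derive_opp f). Qed.

Lemma is_derive_reflect (f : R -> R) (c x df : R) :
  is_derive f (c - x) df -> is_derive (fun t => f (c - t)) x (- df).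
Proof.
  intros H. eapply is_derive_eq.
  - apply (is_derive_comp f (fun t => c - t) x df (-1)); auto.
    auto_derive; auto; ring.
  - unfold scal; simpl; unfold mult; simpl; ring.
Qed.

Lemma is_derive_shift (f : R -> R) (c x df : R) :
  is_derive f (x + c) df -> is_derive (fun t => f (t + c)) x df.
Proof.
  intros H. eapply is_derive_eq.
  - apply (is_derive_comp f (fun t => t + c) x df 1); auto.
    auto_derive; auto; ring.
  - unfold scal; simpl; unfold mult; simpl; ring.
Qed.

Lemma is_derive_Rconst (c x : R) : is_derive (fun _ : R => c) x 0.
Proof. apply (is_derive_const c x). Qed.

Lemma is_derive_Rid (x : R) : is_derive (fun t : R => t) x 1.
Proof. apply (is_derive_id x). Qed.

Lemma is_derive_Rpow (f : R -> R) (n : nat) (x df : R) :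
  is_derive f x df -> is_derive (fun t => f t ^ n) x (INR n * df * f x ^ pred n).
Proof. apply is_derive_pow. Qed.

(** Hypotheses are tried before the structural rules, so abstract functions receive their known
    derivatives; [derive] then leaves an equality between the computed and the expected value. *)
Ltac derive_rule :=
  first
    [ eassumption
    | match goal with H : forall t, is_derive ?f t _ |- is_derive ?f _ _ => apply H end
    | lazymatch goal with
      | |- is_derive (fun t => t) _ _ => apply is_derive_Rid
      | |- is_derive (fun _ => ?c) _ _ => apply is_derive_Rconst
      | |- is_derive (fun t => @?f t + @?g t) _ _ => eapply (is_derive_Rplus f g)
      | |- is_derive (fun t => @?f t - @?g t) _ _ => eapply (is_derive_Rminus f g)
      | |- is_derive (fun t => @?f t * @?g t) _ _ => eapply (is_derive_Rmult f g)
      | |- is_derive (fun t => - @?f t) _ _ => eapply (is_derive_Ropp f)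
      | |- is_derive (fun t => @?f t ^ ?n) _ _ => eapply (is_derive_Rpow f n)
      | |- is_derive (fun t => ?f (?c - t)) _ _ => eapply (is_derive_reflect f c)
      | |- is_derive (fun t => ?f (t + ?c)) _ _ => eapply (is_derive_shift f c)
      | |- is_derive (fun t => ?f t) _ _ => change (fun t => f t) with f
      end ].
Ltac derive := eapply is_derive_eq; [ repeat derive_rule | ].

(** * Monotonicity and first zeros *)

Lemma mean_value (f df : R -> R) (x y : R) :
  x < y -> (forall t, x <= t <= y -> is_derive f t (df t)) ->
  exists c, f y - f x = df c * (y - x) /\ x < c < y.
Proof.
  intros Hxy H. apply MVT_cor2; auto.
  intros; apply is_derive_Reals; auto.
Qed.

Lemma derive_nonneg_le (f df : R -> R) (x y : R) :
  x <= y -> (forall t, x <= t <= y -> is_derive f t (df t)) ->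
  (forall t, x < t < y -> 0 <= df t) -> f x <= f y.
Proof.
  intros [Hxy| ->] H Hp; [|lra].
  destruct (mean_value f df x y Hxy H) as [c [Hc Hc']].
  specialize (Hp c Hc'). nra.
Qed.

Lemma derive_pos_lt (f df : R -> R) (x y : R) :
  x < y -> (forall t, x <= t <= y -> is_derive f t (df t)) ->
  (forall t, x < t < y -> 0 < df t) -> f x < f y.
Proof.
  intros Hxy H Hp.
  destruct (mean_value f df x y Hxy H) as [c [Hc Hc']].
  specialize (Hp c Hc'). nra.
Qed.

Lemma is_derive_continuous (f : R -> R) (x l : R) : is_derive f x l -> continuous f x.
Proof. intros H; apply (ex_derive_continuous f); now exists l. Qed.

Lemma continuous_pos_near (f : R -> R) (x : R) :
  continuous f x -> 0 < f x ->
  exists d, 0 < d /\ forall y, Rabs (y - x) < d -> 0 < f y.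
Proof.
  intros Hc Hp.
  assert (Hl : locally x (fun u => 0 < f u)).
  { apply (Hc (fun u => 0 < u)). now apply open_gt. }
  destruct Hl as [d Hd].
  exists d; split; [apply cond_pos|]. intros y Hy. apply Hd, Hy.
Qed.

(** [z] is the supremum of the times up to which [f] has stayed positive; continuity rules out both
    signs of [f z]. *)
Lemma first_zero (f : R -> R) (x y : R) :
  (forall t, continuous f t) -> 0 < f x -> x <= y -> f y <= 0 ->
  exists z, x < z <= y /\ f z = 0 /\ forall t, x <= t < z -> 0 < f t.
Proof.
  intros Hc Hx Hxy Hy.
  set (E := fun t => x <= t <= y /\ forall s, x <= s <= t -> 0 < f s).
  destruct (completeness E) as [z [Hub Hlub]].
  - exists y. intros t [Ht _]; lra.
  - exists x. split; [lra|]. intros s Hs. now replace s with x by lra.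
  - assert (Hxz : x <= z).
    { apply Hub. split; [lra|]. intros s Hs. now replace s with x by lra. }
    assert (Hzy : z <= y) by (apply Hlub; intros t [Ht _]; lra).
    assert (Hsup : forall s, s < z -> exists e, E e /\ s < e).
    { intros s Hs. destruct (Classical_Prop.classic (exists e, E e /\ s < e)) as [|Hn]; auto.
      exfalso. assert (z <= s); [|lra]. apply Hlub. intros e He.
      destruct (Rle_dec e s); auto. exfalso; apply Hn; exists e; split; auto; lra. }
    assert (Hpos : forall t, x <= t < z -> 0 < f t).
    { intros t Ht. destruct (Hsup t) as [e [[He1 He2] He3]]; [lra|]. apply He2; lra. }
    assert (Hz : f z = 0).
    { destruct (Rtotal_order (f z) 0) as [Hlt|[Heq|Hgt]]; auto; exfalso.
      - destruct (continuous_pos_near (fun t => - f t) z) as [d [Hd1 Hd2]].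
        + apply (continuous_opp f), Hc.
        + lra.
        + assert (x <> z) by (intros ->; lra).
          set (s := Rmax x (z - d / 2)).
          assert (x <= s < z /\ z - d / 2 <= s).
          { unfold s, Rmax; destruct (Rle_dec x (z - d / 2)); lra. }
          specialize (Hpos s ltac:(lra)). specialize (Hd2 s).
          rewrite Rabs_left in Hd2; lra.
      - destruct (continuous_pos_near f z) as [d [Hd1 Hd2]]; auto.
        assert (z <> y) by (intros ->; lra).
        set (s := Rmin y (z + d / 2)).
        assert (z < s <= y /\ s <= z + d / 2).
        { unfold s, Rmin; destruct (Rle_dec y (z + d / 2)); lra. }
        assert (E s); [|specialize (Hub s); cbv beta in Hub; specialize (Hub H1); lra].
        split; [lra|]. intros r Hr. destruct (Rlt_dec r z); [apply Hpos; lra|].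
        apply Hd2. rewrite Rabs_pos_eq; lra. }
    exists z. repeat split; auto. destruct Hxz as [|<-]; auto. lra.
Qed.

(** A positive derivative at [z] would persist just to the left of [z], and [f] would have to climb
    to [f z = 0] from negative values. *)
Lemma derive_nonpos_at_first_zero (f df : R -> R) (x z : R) :
  (forall t, is_derive f t (df t)) -> continuous df z ->
  x < z -> (forall t, x <= t < z -> 0 < f t) -> f z = 0 -> df z <= 0.
Proof.
  intros Hd Hc Hxz Hp Hz.
  destruct (Rle_dec (df z) 0) as [|Hn]; auto. exfalso.
  destruct (continuous_pos_near df z Hc) as [d [Hd1 Hd2]]; [lra|].
  set (s := Rmax x (z - d / 2)).
  assert (x <= s < z /\ z - d / 2 <= s).
  { unfold s, Rmax; destruct (Rle_dec x (z - d / 2)); lra. }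
  assert (f s < f z).
  { apply (derive_pos_lt f df); [lra|auto|].
    intros t Ht. apply Hd2. rewrite Rabs_left; lra. }
  specialize (Hp s ltac:(lra)). lra.
Qed.

(** * Linear second-order equations: existence by Picard iteration *)

Definition linear_sol (q f f1 : R -> R) : Prop :=
  forall t, is_derive f t (f1 t) /\ is_derive f1 t (- (q t * f t)).

Section Picard.

Variables (a : R -> R) (x y M : R).
Hypothesis Ha : forall t, continuous a t.
Hypothesis HM : forall t, Rabs (a t) <= M.

(** These are the increments of the Picard approximations, not the approximations: all terms after
    the first vanish at 0, and the solution is the sum of the series. *)
Fixpoint picard (k : nat) : (R -> R) * (R -> R) :=
  match k with
  | O => (fun _ => x, fun _ => y)
  | S k => (fun t => RInt (snd (picard k)) 0 t,
            fun t => RInt (fun s => - (a s * fst (picard k) s)) 0 t)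
  end.

Let u k := fst (picard k).
Let v k := snd (picard k).

Lemma is_derive_RInt_0 (f : R -> R) (t : R) :
  (forall s, continuous f s) -> is_derive (fun t => RInt f 0 t) t (f t).
Proof.
  intros Hf. apply is_derive_RInt with (a := 0).
  - exists (mkposreal 1 Rlt_0_1). intros z _.
    apply (RInt_correct f), ex_RInt_continuous. intros; apply Hf.
  - apply Hf.
Qed.

Lemma picard_continuous (k : nat) (t : R) : continuous (u k) t /\ continuous (v k) t.
Proof.
  revert t; induction k as [|k IH]; intros t.
  - split; apply continuous_const.
  - split; eapply is_derive_continuous; apply is_derive_RInt_0; intros s.
    + exact (proj2 (IH s)).
    + apply (continuous_opp (fun s => a s * u k s)), (continuous_mult a (u k)); auto.
      exact (proj1 (IH s)).
Qed.

Lemma picard_derive_u (k : nat) (t : R) : is_derive (u (S k)) t (v k t).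
Proof. apply is_derive_RInt_0. intros; apply picard_continuous. Qed.

Lemma picard_derive_v (k : nat) (t : R) : is_derive (v (S k)) t (- (a t * u k t)).
Proof.
  apply (is_derive_RInt_0 (fun s => - (a s * u k s))). intros s.
  apply (continuous_opp (fun s => a s * u k s)), (continuous_mult a (u k)); auto.
  exact (proj1 (picard_continuous k s)).
Qed.

Lemma picard_0 (k : nat) : u (S k) 0 = 0 /\ v (S k) 0 = 0.
Proof. split; unfold u, v; simpl; now rewrite RInt_point. Qed.

(** For [t >= 0] both [G - f] and [G + f] are nondecreasing; negative times follow by reflection. *)
Lemma abs_le_of_derive (f h G g : R -> R) :
  f 0 = 0 -> G 0 = 0 ->
  (forall t, is_derive f t (h t)) -> (forall t, is_derive G t (g t)) ->
  (forall t, Rabs (h t) <= g (Rabs t)) -> forall t, Rabs (f t) <= G (Rabs t).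
Proof.
  assert (Hpos : forall f h : R -> R, f 0 = 0 -> G 0 = 0 ->
    (forall t, is_derive f t (h t)) -> (forall t, is_derive G t (g t)) ->
    (forall t, 0 <= t -> Rabs (h t) <= g t) -> forall t, 0 <= t -> Rabs (f t) <= G t).
  { clear f h. intros f h Hf HG Hdf HdG Hh t Ht.
    assert (H1 : G 0 - f 0 <= G t - f t).
    { apply (derive_nonneg_le (fun s => G s - f s) (fun s => g s - h s)); auto.
      - intros; derive; reflexivity.
      - intros s Hs. specialize (Hh s ltac:(lra)). apply Rabs_le_between in Hh; lra. }
    assert (H2 : G 0 + f 0 <= G t + f t).
    { apply (derive_nonneg_le (fun s => G s + f s) (fun s => g s + h s)); auto.
      - intros; derive; reflexivity.
      - intros s Hs. specialize (Hh s ltac:(lra)). apply Rabs_le_between in Hh; lra. }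
    apply Rabs_le_between; lra. }
  intros Hf HG Hdf HdG Hh t. destruct (Rle_dec 0 t).
  - rewrite (Rabs_pos_eq t) by lra. apply (Hpos f h); auto.
    intros s Hs. specialize (Hh s). now rewrite (Rabs_pos_eq s) in Hh.
  - rewrite (Rabs_left t) by lra.
    replace (f t) with (f (0 - - t)) by (f_equal; ring).
    apply (Hpos (fun s => f (0 - s)) (fun s => - h (0 - s))); auto; try lra.
    + now rewrite Rminus_0_r.
    + intros; derive; reflexivity.
    + intros s Hs. rewrite Rabs_Ropp. specialize (Hh (0 - s)).
      replace (Rabs (0 - s)) with s in Hh; auto.
      rewrite Rminus_0_l, Rabs_Ropp, Rabs_pos_eq; auto.
Qed.

Let C := Rabs x + Rabs y.
Let L := 1 + M.
(** Terms of the series of [C * exp (L * t)]. The rate [L = 1 + M] dominates both the factor 1 in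
    [u' = v] and the factor [M] in [v' = - a u]. *)
Let B k t := C * (/ INR (fact k) * (L * t) ^ k).

Lemma M_nonneg : 0 <= M.
Proof. generalize (HM 0), (Rabs_pos (a 0)); lra. Qed.

(** [B (S k)] vanishes at 0 and has derivative [L * B k], so integrating the bound for [k] gives the
    one for [S k]. *)
Lemma picard_bound (k : nat) (t : R) :
  Rabs (u k t) <= B k (Rabs t) /\ Rabs (v k t) <= B k (Rabs t).
Proof.
  pose proof M_nonneg.
  revert t; induction k as [|k IH]; intros t.
  - unfold u, v, B, C; simpl. generalize (Rabs_pos x), (Rabs_pos y). split; lra.
  - assert (HB : forall s, is_derive (B (S k)) s (L * B k s)).
    { intros s. unfold B. derive. simpl pred; simpl fact.
      change (fact k + k * fact k)%nat with (S k * fact k)%nat.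
      rewrite mult_INR.
      assert (INR (fact k) <> 0) by apply INR_fact_neq_0.
      assert (INR (S k) <> 0) by (apply not_0_INR; lia).
      field; auto. }
    assert (HB0 : B (S k) 0 = 0).
    { unfold B. rewrite Rmult_0_r, pow_ne_zero by lia. ring. }
    destruct (picard_0 k) as [Hu0 Hv0].
    assert (HBp : forall s, 0 <= B k (Rabs s)).
    { intros s. apply Rle_trans with (Rabs (u k s)); [apply Rabs_pos|apply IH]. }
    split; [apply (abs_le_of_derive _ _ _ _ Hu0 HB0 (picard_derive_u k) HB)
           |apply (abs_le_of_derive _ _ _ _ Hv0 HB0 (picard_derive_v k) HB)];
      intros s; destruct (IH s) as [H1 H2]; specialize (HBp s); unfold L.
    + nra.
    + rewrite Rabs_Ropp, Rabs_mult. specialize (HM s).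
      generalize (Rabs_pos (a s)), (Rabs_pos (u k s)). nra.
Qed.

Lemma picard_bound_ball (k : nat) (r t : R) :
  0 <= r -> Rabs t <= r -> B k (Rabs t) <= B k r.
Proof.
  intros Hr Ht. pose proof M_nonneg. unfold B.
  apply Rmult_le_compat_l; [unfold C; generalize (Rabs_pos x), (Rabs_pos y); lra|].
  apply Rmult_le_compat_l.
  - left. apply Rinv_0_lt_compat, INR_fact_lt_0.
  - apply pow_incr. pose proof (Rabs_pos t). unfold L; split; nra.
Qed.

Lemma bound_CVN (w : nat -> R -> R) :
  (forall k t, Rabs (w k t) <= B k (Rabs t)) -> CVN_R w.
Proof.
  intros Hw r. exists (fun k => B k r).
  destruct (exist_exp (L * r)) as [e He].
  exists (C * e). pose proof M_nonneg. pose proof (cond_pos r) as Hr.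
  assert (HC : 0 <= C) by (unfold C; generalize (Rabs_pos x), (Rabs_pos y); lra).
  split.
  - apply (Un_cv_ext (fun n => C * sum_f_R0 (fun i => / INR (fact i) * (L * r) ^ i) n)).
    + intros n. rewrite scal_sum. apply sum_eq. intros i _.
      assert (0 <= / INR (fact i) * (L * r) ^ i).
      { apply Rmult_le_pos; [left; apply Rinv_0_lt_compat, INR_fact_lt_0|].
        apply pow_le. unfold L; nra. }
      unfold B. rewrite Rabs_pos_eq; [ring|]. now apply Rmult_le_pos.
    + apply CV_mult; [|exact He].
      intros eps Heps. exists O. intros. now rewrite Rdist_eq.
  - intros k t Ht. eapply Rle_trans; [apply Hw|].
    apply picard_bound_ball; [lra|]. unfold Boule in Ht. rewrite Rminus_0_r in Ht. lra.
Qed.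

(** The zeroth term is constant and contributes nothing, hence the shift of index by one. *)
Lemma SP_derive_u (N : nat) (t : R) : is_derive (SP u (S N)) t (SP v N t).
Proof.
  unfold SP. induction N as [|N IH].
  - eapply is_derive_eq.
    + apply (is_derive_Rplus (u 0%nat) (u 1%nat));
        [apply (is_derive_Rconst x t)|apply picard_derive_u].
    + simpl; ring.
  - set (F := fun t => sum_f_R0 (fun k => u k t) (S N)) in *.
    apply (is_derive_Rplus F (u (S (S N)))); auto. apply picard_derive_u.
Qed.

Lemma SP_derive_v (N : nat) (t : R) : is_derive (SP v (S N)) t (- (a t * SP u N t)).
Proof.
  unfold SP. induction N as [|N IH].
  - eapply is_derive_eq.
    + apply (is_derive_Rplus (v 0%nat) (v 1%nat));
        [apply (is_derive_Rconst y t)|apply picard_derive_v].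
    + simpl; ring.
  - set (F := fun t => sum_f_R0 (fun k => v k t) (S N)) in *.
    eapply is_derive_eq.
    + apply (is_derive_Rplus F (v (S (S N)))); [apply IH|apply picard_derive_v].
    + simpl. ring.
Qed.

Lemma Un_cv_S (w : nat -> R) (l : R) : Un_cv w l -> Un_cv (fun n => w (S n)) l.
Proof. intros H eps He. destruct (H eps He) as [N HN]. exists N. intros; apply HN; lia. Qed.

(** Normal convergence on balls makes the series of derivatives converge uniformly, which permits
    term-by-term differentiation of both sums. *)
Lemma linear_sol_exists_0 : exists f f1, linear_sol a f f1 /\ f 0 = x /\ f1 0 = y.
Proof.
  assert (Cu : CVN_R u) by (apply bound_CVN; intros; apply picard_bound).
  assert (Cv : CVN_R v) by (apply bound_CVN; intros; apply picard_bound).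
  pose (cu := CVN_R_CVS u Cu). pose (cv := CVN_R_CVS v Cv).
  assert (Lu : forall t, Un_cv (fun n => SP u n t) (SFL u cu t)).
  { intros t. unfold SFL. now destruct (cu t). }
  assert (Lv : forall t, Un_cv (fun n => SP v n t) (SFL v cv t)).
  { intros t. unfold SFL. now destruct (cv t). }
  assert (Hb : forall t, exists r : posreal, Boule 0 r t).
  { intros t. assert (0 < Rabs t + 1) by (generalize (Rabs_pos t); lra).
    exists (mkposreal _ H). unfold Boule; simpl. rewrite Rminus_0_r. lra. }
  pose proof M_nonneg as HM0.
  exists (SFL u cu), (SFL v cv). split; [|split].
  - intros t. destruct (Hb t) as [r Hr]. split; apply is_derive_Reals.
    + apply (CVU_derivable (fun n => SP u (S n)) (SP v)) with (c := 0) (d := r); auto.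
      * apply CVN_CVU, Cv.
      * intros; apply (Un_cv_S (fun n => SP u n x0)); auto.
      * intros; apply is_derive_Reals, SP_derive_u.
    + apply (CVU_derivable (fun n => SP v (S n)) (fun n t => - (a t * SP u n t))
               _ (fun t => - (a t * SFL u cu t))) with (c := 0) (d := r); auto.
      * intros eps Heps.
        (* [1 + M] instead of [M] keeps the divisor positive when [M = 0]. *)
        assert (Heps' : 0 < eps / (1 + M)) by (apply Rdiv_lt_0_compat; lra).
        destruct (CVN_CVU u cu r (Cu r) _ Heps') as [N HN].
        exists N. intros n s Hn Hs. specialize (HN n s Hn Hs).
        replace (- (a s * SFL u cu s) - - (a s * SP u n s))
          with (- (a s * (SFL u cu s - SP u n s))) by ring.
        rewrite Rabs_Ropp, Rabs_mult. specialize (HM s).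
        apply Rmult_lt_compat_r with (r := 1 + M) in HN; [|lra].
        unfold Rdiv in HN. rewrite Rmult_assoc, Rinv_l, Rmult_1_r in HN by lra.
        generalize (Rabs_pos (a s)), (Rabs_pos (SFL u cu s - SP u n s)). nra.
      * intros; apply (Un_cv_S (fun n => SP v n x0)); auto.
      * intros; apply is_derive_Reals, SP_derive_v.
  (* At 0 every partial sum reduces to its zeroth term, the prescribed initial value. *)
  - apply (UL_sequence (fun n => SP u n 0)); auto.
    intros eps Heps. exists O. intros n _.
    replace (SP u n 0) with x; [now rewrite Rdist_eq|].
    unfold SP. induction n as [|n IH]; simpl sum_f_R0; auto.
    rewrite <- IH, (proj1 (picard_0 n)). ring.
  - apply (UL_sequence (fun n => SP v n 0)); auto.
    intros eps Heps. exists O. intros n _.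
    replace (SP v n 0) with y; [now rewrite Rdist_eq|].
    unfold SP. induction n as [|n IH]; simpl sum_f_R0; auto.
    rewrite <- IH, (proj2 (picard_0 n)). ring.
Qed.

End Picard.

Lemma linear_sol_exists (a : R -> R) (M t0 x y : R) :
  (forall t, continuous a t) -> (forall t, Rabs (a t) <= M) ->
  exists f f1, linear_sol a f f1 /\ f t0 = x /\ f1 t0 = y.
Proof.
  intros Ha HM.
  destruct (linear_sol_exists_0 (fun t => a (t + t0)) x y M) as [f [f1 [Hs [Hx Hy]]]].
  - intros t. apply (continuous_comp (fun t => t + t0) a); auto.
    apply (continuous_plus (fun t => t) (fun _ => t0));
      [apply continuous_id|apply continuous_const].
  - intros t; apply HM.
  - exists (fun t => f (t + - t0)), (fun t => f1 (t + - t0)).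
    split; [|now replace (t0 + - t0) with 0 by ring].
    intros t. destruct (Hs (t + - t0)) as [H1 H2]. split; derive; auto.
    do 2 f_equal. f_equal. ring.
Qed.

(** * Solutions of linear equations: symmetries, Wronskians, growth, instability *)

Lemma derive_zero_const (f : R -> R) (x y : R) :
  (forall t, is_derive f t 0) -> f x = f y.
Proof.
  intros H.
  assert (Hle : forall x y, x <= y -> f x = f y).
  { intros u v Huv. apply Rle_antisym.
    - apply (derive_nonneg_le f (fun _ => 0)); auto; intros; lra.
    - apply Ropp_le_cancel.
      apply (derive_nonneg_le (fun t => - f t) (fun _ => 0)); auto; [|intros; lra].
      intros; derive; ring. }
  destruct (Rle_dec x y); [auto|symmetry; apply Hle; lra].
Qed.

Lemma linear_sol_of_hill (a xi : R -> R) :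
  hill_solution a xi -> linear_sol a xi (Derive xi).
Proof.
  intros [Hd He] t. destruct (Hd t) as [H1 H2]. split.
  - now apply Derive_correct.
  - eapply is_derive_eq; [apply Derive_correct, H2|].
    specialize (He t). change (Derive_n xi 2 t) with (Derive (Derive_n xi 1) t) in He.
    change (Derive (Derive_n xi 1) t + a t * xi t = 0) in He.
    change (Derive (Derive_n xi 1) t = - (a t * xi t)). lra.
Qed.

(** Lets a solution built by Picard iteration serve as a witness against [zero_stable], which is
    phrased with [Derive]. *)
Lemma hill_of_linear_sol (a f f1 : R -> R) :
  linear_sol a f f1 -> hill_solution a f /\ forall t, Derive f t = f1 t.
Proof.
  intros H.
  assert (H1 : forall t, Derive f t = f1 t) by (intros; apply is_derive_unique, H).
  assert (H2 : forall t, is_derive (Derive_n f 1) t (- (a t * f t))).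
  { intros t. apply (is_derive_ext f1); [intros; symmetry; apply H1|apply H]. }
  split; auto. split.
  - intros t. split; [exists (f1 t); apply H|]. exists (- (a t * f t)); apply H2.
  - intros t. change (Derive_n f 2 t) with (Derive (Derive_n f 1) t).
    rewrite (is_derive_unique _ _ _ (H2 t)). ring.
Qed.

Lemma linear_sol_reflect (a f f1 : R -> R) (r : R) :
  (forall t, a (r - t) = a t) -> linear_sol a f f1 ->
  linear_sol a (fun t => f (r - t)) (fun t => - f1 (r - t)).
Proof.
  intros Ha H t. destruct (H (r - t)) as [H1 H2]. split; derive; auto.
  rewrite Ha. ring.
Qed.

Lemma linear_sol_shift (a f f1 : R -> R) (r : R) :
  (forall t, a (t + r) = a t) -> linear_sol a f f1 ->
  linear_sol a (fun t => f (t + r)) (fun t => f1 (t + r)).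
Proof.
  intros Ha H t. destruct (H (t + r)) as [H1 H2]. split; derive; auto.
  now rewrite Ha.
Qed.

Lemma wronskian_derive (a b f f1 g g1 : R -> R) (t : R) :
  linear_sol a f f1 -> linear_sol b g g1 ->
  is_derive (fun t => f t * g1 t - f1 t * g t) t ((a t - b t) * (f t * g t)).
Proof.
  intros Hf Hg. destruct (Hf t) as [H1 H2], (Hg t) as [H3 H4]. derive. ring.
Qed.

Lemma wronskian_const (a f f1 g g1 : R -> R) (s t : R) :
  linear_sol a f f1 -> linear_sol a g g1 ->
  f t * g1 t - f1 t * g t = f s * g1 s - f1 s * g s.
Proof.
  intros Hf Hg. apply (derive_zero_const (fun t => f t * g1 t - f1 t * g t)).
  intros u. eapply is_derive_eq; [apply (wronskian_derive a a); auto|ring].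
Qed.

(** A Gronwall argument in both time directions: [N = f^2 + f1^2] has [|N'| <= (1 + M) N], so [N]
    times the exponential of [- (1 + M) u] is nonincreasing and [N] times that of [(1 + M) u] is
    nondecreasing. *)
Lemma linear_sol_growth (q f f1 : R -> R) (M s t : R) :
  linear_sol q f f1 -> (forall u, Rabs (q u) <= M) ->
  f t ^ 2 + f1 t ^ 2 <= exp ((1 + M) * Rabs (t - s)) * (f s ^ 2 + f1 s ^ 2).
Proof.
  intros H HM. set (N := fun u => f u ^ 2 + f1 u ^ 2).
  change (N t <= exp ((1 + M) * Rabs (t - s)) * N s).
  set (N1 := fun u => 2 * (1 - q u) * (f u * f1 u)).
  assert (HN : forall u, is_derive N u (N1 u)).
  { intros u. destruct (H u) as [H1 H2]. unfold N, N1. derive. simpl; ring. }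
  assert (HN1 : forall u, Rabs (N1 u) <= (1 + M) * N u).
  { intros u. unfold N1, N. rewrite !Rabs_mult, (Rabs_pos_eq 2) by lra.
    assert (Rabs (1 - q u) <= 1 + M).
    { specialize (HM u). apply Rabs_le_between in HM. apply Rabs_le_between. lra. }
    rewrite <- (pow2_abs (f u)), <- (pow2_abs (f1 u)).
    pose proof (Rabs_pos (1 - q u)). pose proof (Rabs_pos (f u)).
    pose proof (Rabs_pos (f1 u)).
    assert (0 <= Rabs (f u) * Rabs (f1 u)) by now apply Rmult_le_pos.
    assert (2 * (Rabs (f u) * Rabs (f1 u)) <= Rabs (f u) ^ 2 + Rabs (f1 u) ^ 2)
      by (generalize (pow2_ge_0 (Rabs (f u) - Rabs (f1 u))); nra).
    nra. }
  assert (Hexp : forall k u, is_derive (fun u => exp (k * u)) u (k * exp (k * u))).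
  { intros. auto_derive; auto; ring. }
  destruct (Rle_dec s t) as [Hst|Hst].
  - rewrite Rabs_pos_eq by lra.
    assert (- (exp (- (1 + M) * s) * N s) <= - (exp (- (1 + M) * t) * N t)).
    { apply (derive_nonneg_le (fun u => - (exp (- (1 + M) * u) * N u))
        (fun u => exp (- (1 + M) * u) * ((1 + M) * N u - N1 u))); auto.
      - intros u _. pose proof (Hexp (- (1 + M)) u). derive. ring.
      - intros u _. specialize (HN1 u). apply Rabs_le_between in HN1.
        apply Rmult_le_pos; [left; apply exp_pos|lra]. }
    replace (N t) with (exp ((1 + M) * t) * (exp (- (1 + M) * t) * N t)).
    + replace ((1 + M) * (t - s)) with ((1 + M) * t + - (1 + M) * s) by ring.
      rewrite exp_plus, Rmult_assoc. apply Rmult_le_compat_l; [left; apply exp_pos|lra].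
    + rewrite <- Rmult_assoc, <- exp_plus.
      replace ((1 + M) * t + - (1 + M) * t) with 0 by ring. rewrite exp_0; ring.
  - rewrite Rabs_left by lra.
    assert (exp ((1 + M) * t) * N t <= exp ((1 + M) * s) * N s).
    { apply (derive_nonneg_le (fun u => exp ((1 + M) * u) * N u)
        (fun u => exp ((1 + M) * u) * ((1 + M) * N u + N1 u))); [lra| |].
      - intros u _. pose proof (Hexp (1 + M) u). derive. ring.
      - intros u _. specialize (HN1 u). apply Rabs_le_between in HN1.
        apply Rmult_le_pos; [left; apply exp_pos|lra]. }
    replace (N t) with (exp (- (1 + M) * t) * (exp ((1 + M) * t) * N t)).
    + replace ((1 + M) * - (t - s)) with (- (1 + M) * t + (1 + M) * s) by ring.
      rewrite exp_plus, Rmult_assoc. apply Rmult_le_compat_l; [left; apply exp_pos|lra].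
    + rewrite <- Rmult_assoc, <- exp_plus.
      replace (- (1 + M) * t + (1 + M) * t) with 0 by ring. rewrite exp_0; ring.
Qed.

Lemma linear_sol_zero (q f f1 : R -> R) (M s t : R) :
  linear_sol q f f1 -> (forall u, Rabs (q u) <= M) ->
  f s = 0 -> f1 s = 0 -> f t = 0.
Proof.
  intros H HM H0 H1. pose proof (linear_sol_growth q f f1 M s t H HM) as HG.
  rewrite H0, H1 in HG.
  assert (f t ^ 2 <= 0) by (generalize (pow2_ge_0 (f1 t)); nra).
  generalize (pow2_ge_0 (f t)); nra.
Qed.

(* Where [a <= 0], a solution is convex as long as it is positive. *)
Lemma not_zero_stable_of_nonpos (a : R -> R) (M : R) :
  (forall t, continuous a t) -> (forall t, Rabs (a t) <= M) ->
  (forall t, a t <= 0) -> ~ zero_stable a.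
Proof.
  intros Hc HM Hneg Hst. destruct (Hst 0 1 Rlt_0_1) as [d [Hd Hst']].
  destruct (linear_sol_exists a M 0 (d / 2) (d / 2) Hc HM) as [f [f1 [Hs [H0 H1]]]].
  destruct (hill_of_linear_sol a f f1 Hs) as [Hh HD].
  assert (Hd1 : forall t, is_derive f t (f1 t)) by (intros; apply Hs).
  assert (Hd2 : forall t, is_derive f1 t (- (a t * f t))) by (intros; apply Hs).
  assert (Hcf : forall t, continuous f t) by (intros t; apply (is_derive_continuous f t (f1 t)), Hd1).
  assert (Hgrow : forall z, 0 <= z -> (forall t, 0 <= t < z -> 0 < f t) ->
            d / 2 + d / 2 * z <= f z).
  { intros z Hz Hp.
    assert (Hf1 : forall t, 0 <= t <= z -> d / 2 <= f1 t).
    { intros t Ht. rewrite <- H1.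
      apply (derive_nonneg_le f1 (fun t => - (a t * f t))); auto; [lra|].
      intros u Hu. specialize (Hneg u). specialize (Hp u ltac:(lra)). nra. }
    assert (f 0 - d / 2 * 0 <= f z - d / 2 * z); [|lra].
    apply (derive_nonneg_le (fun t => f t - d / 2 * t) (fun t => f1 t - d / 2)); auto.
    - intros; derive; ring.
    - intros u Hu. specialize (Hf1 u ltac:(lra)). lra. }
  assert (Hpos : forall t, 0 <= t -> 0 < f t).
  { intros t Ht. destruct (Rlt_dec 0 (f t)) as [|Hn]; auto. exfalso.
    destruct (first_zero f 0 t) as [z [Hz1 [Hz2 Hz3]]]; auto; [lra|lra|].
    specialize (Hgrow z ltac:(lra) Hz3). nra. }
  (* At time [2 / d] the linear lower bound equals [d / 2 + 1], which exceeds the tolerance 1. *)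
  assert (Ht : 0 <= 2 / d) by (left; apply Rdiv_lt_0_compat; lra).
  destruct (Hst' f Hh) with (t := 2 / d) as [Hlt _]; auto.
  - rewrite H0, Rabs_pos_eq; lra.
  - rewrite HD, H1, Rabs_pos_eq; lra.
  - assert (d / 2 + d / 2 * (2 / d) <= f (2 / d)) by (apply Hgrow; auto; intros; apply Hpos; lra).
    replace (d / 2 * (2 / d)) with 1 in H by (field; lra).
    rewrite Rabs_pos_eq in Hlt; [lra|]. left; auto.
Qed.

(* With [a] even about [s1], reflecting a solution about [s1] turns the values
   over one period into Wronskians at the half period [s1]. *)
Lemma monodromy_invariant (a c c1 s s' f f1 : R -> R) (s0 s1 : R) :
  (forall t, a (2 * s1 - t) = a t) ->
  linear_sol a c c1 -> c s0 = 1 -> c1 s0 = 0 ->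
  linear_sol a s s' -> s s0 = 0 -> s' s0 = 1 ->
  linear_sol a f f1 ->
  let s2 := s0 + 2 * (s1 - s0) in
  - (c s1 * c1 s1) * f s2 ^ 2 + s s1 * s' s1 * f1 s2 ^ 2 =
  - (c s1 * c1 s1) * f s0 ^ 2 + s s1 * s' s1 * f1 s0 ^ 2.
Proof.
  intros Ha Hc C0 C1 Hs S0 S1 Hf s2.
  (* The reflected solution has data [(f s1, - f1 s1)] at [s1] and [(f s2, - f1 s2)] at [s0], so the
     four Wronskians express the data of [f] at [s0] and [s2] through those at [s1]. *)
  pose proof (linear_sol_reflect a f f1 _ Ha Hf) as Hr.
  pose proof (wronskian_const a f f1 c c1 s0 s1 Hf Hc) as W1.
  pose proof (wronskian_const a f f1 s s' s0 s1 Hf Hs) as W2.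
  pose proof (wronskian_const a _ _ c c1 s0 s1 Hr Hc) as W3.
  pose proof (wronskian_const a _ _ s s' s0 s1 Hr Hs) as W4.
  cbv beta in W3, W4.
  replace (2 * s1 - s0) with s2 in * by (unfold s2; ring).
  replace (2 * s1 - s1) with s1 in * by ring.
  rewrite C0, C1 in *. rewrite S0, S1 in *.
  assert (f1 s2 = f s1 * c1 s1 + f1 s1 * c s1) by lra.
  assert (f1 s0 = - (f s1 * c1 s1) + f1 s1 * c s1) by lra.
  assert (f s2 = f s1 * s' s1 + f1 s1 * s s1) by lra.
  assert (f s0 = f s1 * s' s1 - f1 s1 * s s1) by lra.
  (* From [s0] to [s2], [f^2] grows by [4 f f1 s s'] and [f1^2] by [4 f f1 c c1], all taken at [s1];
     the weights make these cancel. *)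
  rewrite H, H0, H1, H2. ring.
Qed.

(** * Stability from a quadratic form conserved over a period *)

Lemma periodic_floor (s T t : R) :
  0 < T -> s <= t -> exists k : nat, s + INR k * T <= t <= s + INR k * T + T.
Proof.
  intros HT Hst.
  destruct (nfloor_ex ((t - s) / T)) as [k [Hk1 Hk2]].
  - apply Rmult_le_pos; [lra|]. left; now apply Rinv_0_lt_compat.
  - exists k.
    assert (t - s = (t - s) / T * T) by (field; lra). nra.
Qed.

(** The growth up to a late time splits into three bounded factors: [X] from [t0] to [s0], [R0] over
    any number of whole periods, and [Y] over the last incomplete period. *)
Lemma stable_of_invariant_form (a : R -> R) (M T t0 s0 al be : R) :
  (forall t, Rabs (a t) <= M) -> (forall t, a (t + T) = a t) ->
  0 < T -> t0 <= s0 -> 0 < al -> 0 < be ->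
  (forall f f1, linear_sol a f f1 ->
     al * f (s0 + T) ^ 2 + be * f1 (s0 + T) ^ 2 = al * f s0 ^ 2 + be * f1 s0 ^ 2) ->
  forall eps, 0 < eps -> exists delta, 0 < delta /\
    forall f f1, linear_sol a f f1 -> Rabs (f t0) < delta -> Rabs (f1 t0) < delta ->
    forall t, t0 <= t -> Rabs (f t) < eps /\ Rabs (f1 t) < eps.
Proof.
  intros HM Hper HT Hts Hal Hbe Hinv eps Heps.
  assert (HM0 : 0 <= M) by (generalize (HM 0), (Rabs_pos (a 0)); lra).
  set (X := exp ((1 + M) * (s0 - t0))).
  set (Y := exp ((1 + M) * T)).
  (* [R0] dominates the ratio of the larger to the smaller of [al] and [be], the cost of comparing
     the form with the Euclidean norm twice. *)
  set (R0 := (al + be) * (/ al + / be)).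
  assert (HX : 1 <= X).
  { unfold X. generalize (exp_ineq1_le ((1 + M) * (s0 - t0))). nra. }
  assert (HY : 1 <= Y) by (unfold Y; generalize (exp_ineq1_le ((1 + M) * T)); nra).
  assert (Hal' : 0 < / al) by now apply Rinv_0_lt_compat.
  assert (Hbe' : 0 < / be) by now apply Rinv_0_lt_compat.
  assert (HR : 1 <= R0).
  { unfold R0. assert (al * / al = 1) by (field; lra).
    assert (0 < al * / be) by now apply Rmult_lt_0_compat.
    assert (0 < be * / al) by now apply Rmult_lt_0_compat.
    assert (0 < be * / be) by now apply Rmult_lt_0_compat. nra. }
  set (K := Y * (R0 * X)).
  assert (HRX : X <= R0 * X) by nra.
  assert (HK : X <= K) by (unfold K; nra).
  assert (Hbound : forall f f1, linear_sol a f f1 -> forall t, t0 <= t ->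
            f t ^ 2 + f1 t ^ 2 <= K * (f t0 ^ 2 + f1 t0 ^ 2)).
  { intros f f1 Hf t Ht.
    assert (Hexp : forall u v d, Rabs (v - u) <= d ->
              f v ^ 2 + f1 v ^ 2 <= exp ((1 + M) * d) * (f u ^ 2 + f1 u ^ 2)).
    { intros u v d Hd. eapply Rle_trans; [apply (linear_sol_growth a f f1 M u v Hf HM)|].
      apply Rmult_le_compat_r; [generalize (pow2_ge_0 (f u)), (pow2_ge_0 (f1 u)); lra|].
      destruct Hd as [Hd|Hd]; [left; apply exp_increasing; nra|right; now rewrite Hd]. }
    assert (HN0 : 0 <= f t0 ^ 2 + f1 t0 ^ 2)
      by (generalize (pow2_ge_0 (f t0)), (pow2_ge_0 (f1 t0)); lra).
    destruct (Rle_dec s0 t) as [Hst|Hst].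
    - destruct (periodic_floor s0 T t HT Hst) as [k Hk].
      assert (Hshift : forall k, linear_sol a (fun t => f (t + INR k * T))
                                   (fun t => f1 (t + INR k * T))).
      { intros j. apply linear_sol_shift; auto. induction j as [|j IH]; intros u.
        - simpl. f_equal; ring.
        - rewrite S_INR. rewrite <- (IH u), <- (Hper (u + INR j * T)). f_equal; ring. }
      (* The one-period law is applied to the translate of [f] by [j] periods, again a solution. *)
      assert (Hk' : forall k, al * f (s0 + INR k * T) ^ 2 + be * f1 (s0 + INR k * T) ^ 2
                        = al * f s0 ^ 2 + be * f1 s0 ^ 2).
      { induction k0 as [|j IH].
        - simpl INR. now replace (s0 + 0 * T) with s0 by ring.
        - rewrite <- IH. rewrite <- (Hinv _ _ (Hshift j)). rewrite S_INR.
          now replace (s0 + (INR j + 1) * T) with (s0 + T + INR j * T) by ring. }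
      specialize (Hk' k). set (tk := s0 + INR k * T) in *.
      assert (H1 : f t ^ 2 + f1 t ^ 2 <= Y * (f tk ^ 2 + f1 tk ^ 2)).
      { apply Hexp. rewrite Rabs_pos_eq; lra. }
      assert (H2 : f s0 ^ 2 + f1 s0 ^ 2 <= X * (f t0 ^ 2 + f1 t0 ^ 2)).
      { apply Hexp. rewrite Rabs_pos_eq; lra. }
      assert (H3 : f tk ^ 2 + f1 tk ^ 2 <= R0 * (f s0 ^ 2 + f1 s0 ^ 2)).
      { apply Rle_trans with ((/ al + / be) * (al * f tk ^ 2 + be * f1 tk ^ 2)).
        - replace ((/ al + / be) * (al * f tk ^ 2 + be * f1 tk ^ 2))
            with (f tk ^ 2 + f1 tk ^ 2 + / be * (al * f tk ^ 2) + / al * (be * f1 tk ^ 2))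
            by (field; lra).
          assert (0 <= / be * (al * f tk ^ 2))
            by (apply Rmult_le_pos; [lra|apply Rmult_le_pos; [lra|apply pow2_ge_0]]).
          assert (0 <= / al * (be * f1 tk ^ 2))
            by (apply Rmult_le_pos; [lra|apply Rmult_le_pos; [lra|apply pow2_ge_0]]).
          lra.
        - rewrite Hk'. unfold R0. rewrite (Rmult_comm (al + be)), Rmult_assoc.
          apply Rmult_le_compat_l; [lra|].
          generalize (pow2_ge_0 (f s0)), (pow2_ge_0 (f1 s0)). nra. }
      unfold K. rewrite !Rmult_assoc.
      eapply Rle_trans; [apply H1|]. apply Rmult_le_compat_l; [lra|].
      eapply Rle_trans; [apply H3|]. apply Rmult_le_compat_l; lra.
    - eapply Rle_trans; [apply (Hexp t0 t (s0 - t0)); rewrite Rabs_pos_eq; lra|].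
      fold X. apply Rmult_le_compat_r; lra. }
  assert (HK1 : 1 <= K) by lra.
  (* With [d] this radius, the bound is [K * (2 * d^2)], below [eps^2 = 4 * K^2 * d^2] because
     [K >= 1]. *)
  exists (eps / (2 * K)). split; [apply Rdiv_lt_0_compat; lra|].
  intros f f1 Hf H0 H1 t Ht. specialize (Hbound f f1 Hf t Ht).
  set (d := eps / (2 * K)) in *.
  assert (Hd : eps = d * (2 * K)) by (unfold d; field; lra).
  assert (Hd0 : 0 < d) by (unfold d; apply Rdiv_lt_0_compat; lra).
  assert (Hsq : forall z, Rabs z < d -> z ^ 2 < d ^ 2).
  { intros z Hz. rewrite <- (pow2_abs z). generalize (Rabs_pos z). simpl. nra. }
  apply Hsq in H0, H1.
  assert (Hlt : f t ^ 2 + f1 t ^ 2 < eps ^ 2).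
  { apply Rle_lt_trans with (1 := Hbound). rewrite Hd.
    assert (0 < K * d ^ 2) by (apply Rmult_lt_0_compat; [lra|apply pow_lt; lra]).
    simpl in *. nra. }
  assert (Hsq' : forall z, z ^ 2 < eps ^ 2 -> Rabs z < eps).
  { intros z Hz. rewrite <- (pow2_abs z) in Hz. generalize (Rabs_pos z). simpl in Hz. nra. }
  generalize (pow2_ge_0 (f t)), (pow2_ge_0 (f1 t)). split; apply Hsq'; lra.
Qed.

(** * The Duffing equation: energy, uniqueness, oscillation, symmetry *)

Section Duffing.

Variables A B : R.
Hypothesis HA : 0 <= A.
Hypothesis HB : 0 < B.

Definition duffing_flow (th th1 : R -> R) : Prop :=
  linear_sol (fun t => A + B * th t ^ 2) th th1.

Definition level (x y : R) : R := y ^ 2 / 2 + A / 2 * x ^ 2 + B / 4 * x ^ 4.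

Lemma level_const (th th1 : R -> R) (s t : R) :
  duffing_flow th th1 -> level (th t) (th1 t) = level (th s) (th1 s).
Proof.
  intros H. apply (derive_zero_const (fun t => level (th t) (th1 t))).
  intros u. destruct (H u) as [H1 H2]. unfold level, Rdiv. derive. simpl. field.
Qed.

Lemma level_bound (x y E : R) : level x y = E -> B * x ^ 4 <= 4 * E.
Proof.
  unfold level. intros <-. generalize (pow2_ge_0 x), (pow2_ge_0 y). nra.
Qed.

Lemma level_sq_bound (x y E : R) : level x y = E -> B * x ^ 2 <= 1 + 4 * B * E.
Proof.
  intros H. apply level_bound in H.
  assert ((B * x ^ 2) ^ 2 <= 4 * B * E).
  { replace ((B * x ^ 2) ^ 2) with (B * (B * x ^ 4)) by ring. nra. }
  generalize (pow2_ge_0 (B * x ^ 2 - 1)). nra.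
Qed.

Lemma duffing_flow_opp (th th1 : R -> R) :
  duffing_flow th th1 -> duffing_flow (fun t => - th t) (fun t => - th1 t).
Proof. intros H t. destruct (H t) as [H1 H2]. split; derive; auto. ring. Qed.

Lemma duffing_flow_reflect (th th1 : R -> R) (r : R) :
  duffing_flow th th1 -> duffing_flow (fun t => th (r - t)) (fun t => - th1 (r - t)).
Proof. intros H t. destruct (H (r - t)) as [H1 H2]. split; derive; auto. ring. Qed.

(** Factoring the difference of cubes, [th - ph] solves a linear equation with coefficient [q],
    which energy conservation keeps bounded; zero data then force the zero solution. *)
Lemma duffing_unique (th th1 ph ph1 : R -> R) (s t : R) :
  duffing_flow th th1 -> duffing_flow ph ph1 ->
  th s = ph s -> th1 s = ph1 s -> th t = ph t.
Proof.
  intros Ht Hp H0 H1.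
  set (q := fun u => A + B * (th u ^ 2 + th u * ph u + ph u ^ 2)).
  assert (Hw : linear_sol q (fun u => th u - ph u) (fun u => th1 u - ph1 u)).
  { intros u. destruct (Ht u) as [H2 H3], (Hp u) as [H4 H5].
    split; derive; auto. unfold q; ring. }
  set (E := level (th s) (th1 s)).
  assert (HM : forall u, Rabs (q u) <= A + 4 * (1 + 4 * B * E)).
  { intros u.
    assert (L1 : B * th u ^ 2 <= 1 + 4 * B * E)
      by (apply (level_sq_bound _ (th1 u)); now apply level_const).
    assert (L2 : B * ph u ^ 2 <= 1 + 4 * B * E).
    { apply (level_sq_bound _ (ph1 u)). unfold E. rewrite H0, H1. now apply level_const. }
    assert (0 <= th u ^ 2 + th u * ph u + ph u ^ 2 <= 2 * (th u ^ 2 + ph u ^ 2)).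
    { generalize (pow2_ge_0 (th u + ph u)), (pow2_ge_0 (th u - ph u)),
        (pow2_ge_0 (th u)), (pow2_ge_0 (ph u)). nra. }
    unfold q. rewrite Rabs_pos_eq; nra. }
  enough (th t - ph t = 0) by lra.
  apply (linear_sol_zero _ _ _ _ s t Hw HM); lra.
Qed.

(** A positive solution is concave, so its slope can never be negative; hence it stays above
    [th t0], and the restoring force, bounded below by [k > 0], eventually makes the slope
    negative. *)
Lemma duffing_positive_absurd (th th1 : R -> R) (t0 : R) :
  duffing_flow th th1 -> ~ (forall t, t0 <= t -> 0 < th t).
Proof.
  intros H Hpos.
  assert (Hd1 : forall t, is_derive th t (th1 t)) by (intros; apply H).
  assert (Hd2 : forall t, is_derive th1 t (- ((A + B * th t ^ 2) * th t)))
    by (intros; apply H).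
  assert (Hneg : forall t, t0 <= t -> (A + B * th t ^ 2) * th t >= 0).
  { intros t Ht. specialize (Hpos t Ht). generalize (pow2_ge_0 (th t)).
    intros. apply Rle_ge, Rmult_le_pos; nra. }
  assert (Hdec : forall u v, t0 <= u -> u <= v -> th1 v <= th1 u).
  { intros u v Hu Huv. apply Ropp_le_cancel.
    apply (derive_nonneg_le (fun t => - th1 t) (fun t => (A + B * th t ^ 2) * th t)); auto.
    - intros; derive; ring.
    - intros t Ht. specialize (Hneg t ltac:(lra)). lra. }
  assert (Hth1 : forall t, t0 <= t -> 0 <= th1 t).
  { intros t Ht. destruct (Rle_dec 0 (th1 t)) as [|Hn]; auto. exfalso.
    (* Time after which the tangent line at [t] reaches zero. *)
    set (L := th t / - th1 t).
    assert (HL : 0 < L) by (apply Rdiv_lt_0_compat; [now apply Hpos|lra]).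
    assert (Hle : th1 t * t - th t <= th1 t * (t + L) - th (t + L)).
    { apply (derive_nonneg_le (fun u => th1 t * u - th u) (fun u => th1 t - th1 u)); [lra| |].
      - intros; derive; ring.
      - intros u Hu. specialize (Hdec t u). lra. }
    assert (th1 t * L = - th t) by (unfold L; field; lra).
    specialize (Hpos (t + L) ltac:(lra)). nra. }
  assert (Hinc : forall t, t0 <= t -> th t0 <= th t).
  { intros t Ht. apply (derive_nonneg_le th th1); auto. intros; apply Hth1; lra. }
  pose proof (Hpos t0 ltac:(lra)) as H0.
  set (k := B * th t0 ^ 3).
  assert (Hk : 0 < k) by (apply Rmult_lt_0_compat; auto; now apply pow_lt).
  assert (Hforce : forall t, t0 <= t -> k <= (A + B * th t ^ 2) * th t).
  { intros t Ht. specialize (Hinc t Ht). unfold k.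
    assert (th t0 ^ 3 <= th t ^ 3) by (apply pow_incr; lra). simpl in *. nra. }
  (* Time for a slope decreasing at rate at least [k] to fall from [th1 t0] to [-1] or below. *)
  set (L := (th1 t0 + 1) / k). pose proof (Hth1 t0 ltac:(lra)) as H1.
  assert (HL : 0 < L) by (apply Rdiv_lt_0_compat; lra).
  assert (Hle : - th1 t0 - k * t0 <= - th1 (t0 + L) - k * (t0 + L)).
  { apply (derive_nonneg_le (fun t => - th1 t - k * t)
             (fun t => (A + B * th t ^ 2) * th t - k)); [lra| |].
    - intros; derive; ring.
    - intros t Ht. specialize (Hforce t ltac:(lra)). lra. }
  assert (k * L = th1 t0 + 1) by (unfold L; field; lra).
  specialize (Hth1 (t0 + L) ltac:(lra)). nra.
Qed.

Lemma duffing_zero (th th1 : R -> R) (t0 : R) :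
  duffing_flow th th1 -> exists s, t0 <= s /\ th s = 0.
Proof.
  assert (Hpos : forall th th1, duffing_flow th th1 -> 0 < th t0 ->
            exists s, t0 <= s /\ th s = 0).
  { clear th th1. intros th th1 H H0.
    destruct (Classical_Prop.classic (forall t, t0 <= t -> 0 < th t)) as [Hp|Hn].
    - destruct (duffing_positive_absurd _ _ _ H Hp).
    - apply Classical_Pred_Type.not_all_ex_not in Hn. destruct Hn as [t Ht].
      apply Classical_Prop.imply_to_and in Ht. destruct Ht as [Ht Hn].
      destruct (first_zero th t0 t) as [z [Hz1 [Hz2 _]]]; auto; [|lra|].
      + intros u. apply (is_derive_continuous th u (th1 u)). exact (proj1 (H u)).
      + exists z; split; auto; lra. }
  intros H. destruct (Rtotal_order (th t0) 0) as [Hlt|[Heq|Hgt]].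
  - destruct (Hpos _ _ (duffing_flow_opp _ _ H)) as [s [Hs1 Hs2]]; [lra|].
    exists s; split; auto; lra.
  - exists t0; split; auto; lra.
  - now apply (Hpos th th1).
Qed.

(** [ph] is [th] or its opposite, the sign making [ph1 s0] positive; the Hill coefficient sees only
    the square. The critical point comes from the mean value theorem between two zeros. *)
Lemma duffing_quarter_period (th th1 : R -> R) (t0 E : R) :
  duffing_flow th th1 -> (forall t, level (th t) (th1 t) = E) -> 0 < E ->
  exists ph ph1 s0 s1, duffing_flow ph ph1 /\ (forall t, ph t ^ 2 = th t ^ 2) /\
    (forall t, level (ph t) (ph1 t) = E) /\ t0 <= s0 /\ s0 < s1 /\
    ph s0 = 0 /\ ph1 s1 = 0 /\ (forall t, s0 <= t < s1 -> 0 < ph1 t).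
Proof.
  intros H HE HE0. destruct (duffing_zero th th1 t0 H) as [s0 [Hs0 Hz]].
  assert (Hsgn : exists ph ph1, duffing_flow ph ph1 /\ (forall t, ph t ^ 2 = th t ^ 2) /\
    (forall t, level (ph t) (ph1 t) = E) /\ ph s0 = 0 /\ 0 < ph1 s0).
  { assert (H1 : th1 s0 <> 0).
    { intros H1. specialize (HE s0). rewrite Hz, H1 in HE. unfold level in HE. simpl in HE. lra. }
    destruct (Rlt_dec 0 (th1 s0)) as [Hp|Hn].
    - exists th, th1. auto.
    - exists (fun t => - th t), (fun t => - th1 t).
      repeat split; try (apply duffing_flow_opp in H; apply H); intros.
      + ring.
      + rewrite <- (HE t). unfold level. field.
      + lra.
      + lra. }
  destruct Hsgn as [ph [ph1 [Hph [Hsq [Hlev [Hph0 Hph1]]]]]].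
  (* Searching from [s0 + 1] guarantees a zero different from [s0]. *)
  destruct (duffing_zero ph ph1 (s0 + 1) Hph) as [s2 [Hs2 Hz2]].
  destruct (mean_value ph ph1 s0 s2) as [c [Hc1 Hc2]]; [lra|intros; apply Hph|].
  assert (Hc : ph1 c = 0) by nra.
  destruct (first_zero ph1 s0 c) as [s1 [Hs1 [Hs1' Hp]]]; auto; try lra.
  - intros u. eapply (is_derive_continuous ph1 u). exact (proj2 (Hph u)).
  - exists ph, ph1, s0, s1. repeat split; auto; try lra; apply Hph.
Qed.

(** The reflected solution has the same value and derivative at the critical point, so uniqueness
    applies. *)
Lemma duffing_even (ph ph1 : R -> R) (s1 t : R) :
  duffing_flow ph ph1 -> ph1 s1 = 0 -> ph (2 * s1 - t) = ph t.
Proof.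
  intros H H1. pose proof (duffing_flow_reflect _ _ (2 * s1) H) as Hr.
  apply (duffing_unique _ _ ph ph1 s1 t Hr H); replace (2 * s1 - s1) with s1 by ring; lra.
Qed.

Lemma duffing_odd (ph ph1 : R -> R) (s0 t : R) :
  duffing_flow ph ph1 -> ph s0 = 0 -> ph (2 * s0 - t) = - ph t.
Proof.
  intros H H0. pose proof (duffing_flow_opp _ _ (duffing_flow_reflect _ _ (2 * s0) H)) as Hr.
  enough (- ph (2 * s0 - t) = ph t) by lra.
  apply (duffing_unique _ _ ph ph1 s0 t Hr H); replace (2 * s0 - s0) with s0 by ring; lra.
Qed.

(** * Sturm comparisons on a quarter period *)

Section Comparison.

Variables (a ph ph1 : R -> R) (s0 s1 : R).
Hypothesis Hph : duffing_flow ph ph1.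
Hypothesis Hlt : forall t, a t < A + B * ph t ^ 2.
Hypothesis Hs : s0 < s1.
Hypothesis Hph0 : ph s0 = 0.
Hypothesis Hph1 : ph1 s1 = 0.
Hypothesis Hpos : forall t, s0 <= t < s1 -> 0 < ph1 t.

Lemma quarter_pos (t : R) : s0 < t <= s1 -> 0 < ph t.
Proof.
  intros Ht. rewrite <- Hph0. apply (derive_pos_lt ph ph1); [lra|intros; apply Hph|].
  intros; apply Hpos; lra.
Qed.

Lemma quarter_pos1 (t : R) : s0 <= t <= s1 -> 0 <= ph1 t.
Proof.
  intros Ht. destruct (Req_dec t s1) as [->|]; [lra|]. left; apply Hpos; lra.
Qed.

(** The Wronskian [s * ph1 - s' * ph] starts at 0 and strictly decreases while [s] and [ph] are
    positive, yet at a first zero [z] of [s'] it would be [s z * ph1 z >= 0]. *)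
Lemma sine_monotone (s s' : R -> R) (t : R) :
  linear_sol a s s' -> s s0 = 0 -> s' s0 = 1 ->
  s0 <= t <= s1 -> 0 < s' t.
Proof.
  intros Hsol S0 S1 Ht. destruct (Rlt_dec 0 (s' t)) as [|Hn]; auto. exfalso.
  destruct (first_zero s' s0 t) as [z [Hz1 [Hz2 Hz3]]]; try lra.
  { intros u. apply (is_derive_continuous s' u _ (proj2 (Hsol u))). }
  assert (Hsp : forall u, s0 < u <= z -> 0 < s u).
  { intros u Hu. rewrite <- S0. apply (derive_pos_lt s s'); [lra|intros; apply Hsol|].
    intros; apply Hz3; lra. }
  assert (Hw : - (s s0 * ph1 s0 - s' s0 * ph s0) < - (s z * ph1 z - s' z * ph z)).
  { apply (derive_pos_lt (fun u => - (s u * ph1 u - s' u * ph u))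
             (fun u => (A + B * ph u ^ 2 - a u) * (s u * ph u))); [lra| |].
    - intros u _. eapply is_derive_eq.
      + apply (is_derive_Ropp (fun u => s u * ph1 u - s' u * ph u)).
        apply (wronskian_derive a _ s s' ph ph1 u Hsol Hph).
      + cbv beta. ring.
    - intros u Hu. specialize (Hlt u). apply Rmult_lt_0_compat; [lra|].
      apply Rmult_lt_0_compat; [apply Hsp; lra|apply quarter_pos; lra]. }
  rewrite S0, Hph0, Hz2 in Hw.
  specialize (Hsp z ltac:(lra)). pose proof (quarter_pos1 z ltac:(lra)). nra.
Qed.

(* The comparison function is [ph1], which solves the variational equation
   [ph1'' + (A + 3 B ph^2) ph1 = 0] and satisfies [ph1' s0 = 0], [ph1 s1 = 0]. *)
Lemma cosine_pos (c c1 : R -> R) (t : R) :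
  linear_sol a c c1 -> c s0 = 1 -> c1 s0 = 0 ->
  s0 <= t <= s1 -> 0 < c t.
Proof.
  intros Hsol C0 C1 Ht. destruct (Rlt_dec 0 (c t)) as [|Hn]; auto. exfalso.
  assert (Hcont : forall u, continuous c u)
    by (intros u; apply (is_derive_continuous c u _ (proj1 (Hsol u)))).
  destruct (first_zero c s0 t) as [z [Hz1 [Hz2 Hz3]]]; auto; try lra.
  assert (Hc1 : c1 z <= 0).
  { apply (derive_nonpos_at_first_zero c c1 s0 z); auto; [apply Hsol| |lra].
    apply (is_derive_continuous c1 z _ (proj2 (Hsol z))). }
  set (p1 := fun u => - ((A + B * ph u ^ 2) * ph u)).
  assert (Hp : linear_sol (fun u => A + 3 * B * ph u ^ 2) ph1 p1).
  { intros u. destruct (Hph u) as [H1 H2]. split; [exact H2|].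
    unfold p1. derive. simpl; ring. }
  assert (Hw : - (c s0 * p1 s0 - c1 s0 * ph1 s0) < - (c z * p1 z - c1 z * ph1 z)).
  { apply (derive_pos_lt (fun u => - (c u * p1 u - c1 u * ph1 u))
             (fun u => (A + 3 * B * ph u ^ 2 - a u) * (c u * ph1 u))); [lra| |].
    - intros u _. eapply is_derive_eq.
      + apply (is_derive_Ropp (fun u => c u * p1 u - c1 u * ph1 u)).
        apply (wronskian_derive a _ c c1 ph1 p1 u Hsol Hp).
      + cbv beta. ring.
    - intros u Hu. specialize (Hlt u). apply Rmult_lt_0_compat.
      + generalize (pow2_ge_0 (ph u)). nra.
      + apply Rmult_lt_0_compat; [apply Hz3; lra|apply Hpos; lra]. }
  (* The left side is now 0 and the right side [c1 z * ph1 z], which is nonpositive. *)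
  unfold p1 in Hw. rewrite C0, C1, Hph0, Hz2 in Hw.
  pose proof (quarter_pos1 z ltac:(lra)). simpl in Hw. nra.
Qed.

(* The test function is [1 + e ph^2], whose derivative vanishes at both ends. *)
Lemma cosine_derive_neg (c c1 : R -> R) (D K E : R) :
  (forall t, a t = D * ph t ^ 2 - K) -> 0 < K -> 0 < D ->
  (forall t, level (ph t) (ph1 t) = E) -> 0 < E ->
  (4 * A + K) * K <= D * E -> 36 * B * K ^ 2 <= D ^ 2 * E ->
  linear_sol a c c1 -> c s0 = 1 -> c1 s0 = 0 -> c1 s1 < 0.
Proof.
  intros Ha HK HD HE HE0 HE1 HE2 Hsol C0 C1.
  (* Chosen so that [2 * E * e = K]: the constant term of [g'' + a g] becomes
     [2 * K - K = K > 0]. *)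
  set (e := K / (2 * E)).
  assert (He : 2 * E * e = K) by (unfold e; field; lra).
  assert (He0 : 0 < e) by (apply Rdiv_lt_0_compat; lra).
  set (g := fun u => 1 + e * ph u ^ 2). set (g1 := fun u => 2 * e * (ph u * ph1 u)).
  set (g2 := fun u => 2 * e * (ph1 u ^ 2 - (A + B * ph u ^ 2) * ph u ^ 2)).
  assert (Hw : c s0 * g1 s0 - c1 s0 * g s0 < c s1 * g1 s1 - c1 s1 * g s1).
  { apply (derive_pos_lt (fun u => c u * g1 u - c1 u * g u)
             (fun u => c u * (g2 u + a u * g u))); [lra| |].
    - intros u _. destruct (Hph u) as [H1 H2], (Hsol u) as [H3 H4].
      unfold g, g1, g2. derive. simpl; ring.
    - intros u Hu. apply Rmult_lt_0_compat; [apply (cosine_pos c c1); auto; lra|].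
      unfold g2, g. rewrite Ha.
      assert (Hv : ph1 u ^ 2 = 2 * E - A * ph u ^ 2 - B / 2 * (ph u ^ 2) ^ 2)
        by (rewrite <- (HE u); unfold level; field).
      pose proof (level_bound _ _ _ (HE u)) as Hx4.
      replace (ph u ^ 4) with ((ph u ^ 2) ^ 2) in Hx4 by ring.
      rewrite Hv. pose proof (pow2_ge_0 (ph u)) as Hx.
      set (x := ph u ^ 2) in *. clearbody x.
      (* The term [D * x] is split in two: one half absorbs the linear loss [(4 * A + K) * e * x],
         the other the quadratic loss [3 * B * e * x^2]. *)
      assert (Hlin : (4 * A + K) * e <= D / 2).
      { apply Rmult_le_reg_l with (2 * E); [lra|].
        replace (2 * E * ((4 * A + K) * e)) with ((4 * A + K) * (2 * E * e)) by ring.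
        rewrite He. lra. }
      (* Squaring lets the energy bound [B * x^2 <= 4 * E] replace a square root. *)
      assert (Hquad : 6 * B * e * x <= D).
      { apply Rsqr_incr_0_var; [|lra]. unfold Rsqr.
        apply Rmult_le_reg_r with E; auto.
        replace (6 * B * e * x * (6 * B * e * x) * E)
          with (36 * B * (e * e) * (B * x ^ 2) * E) by ring.
        apply Rle_trans with (36 * B * (e * e) * (4 * E) * E).
        - apply Rmult_le_compat_r; [lra|]. apply Rmult_le_compat_l; auto.
          apply Rmult_le_pos; nra.
        - replace (36 * B * (e * e) * (4 * E) * E) with (36 * B * (2 * E * e) ^ 2) by ring.
          rewrite He. lra. }
      assert (Hexp : 2 * e * (2 * E - A * x - B / 2 * x ^ 2 - (A + B * x) * x)
                + (D * x - K) * (1 + e * x)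
              = 2 * (2 * E * e) - K + x * (D - (4 * A + K) * e) - 3 * B * e * x * x
                + D * e * x * x) by field.
      rewrite Hexp, He.
      assert (0 <= x * (D / 2 - (4 * A + K) * e)) by (apply Rmult_le_pos; lra).
      assert (0 <= x * (D - 6 * B * e * x)) by (apply Rmult_le_pos; lra).
      assert (0 <= D * e * x * x) by (apply Rmult_le_pos; [apply Rmult_le_pos; [apply Rmult_le_pos|]|]; lra).
      lra. }
  unfold g1 in Hw. rewrite C0, C1, Hph0, Hph1 in Hw.
  assert (0 < g s1) by (unfold g; generalize (pow2_ge_0 (ph s1)); nra).
  nra.
Qed.

End Comparison.

(** * Stability at large energy *)

Lemma hill_stable (a th th1 : R -> R) (D K E : R) :
  duffing_flow th th1 -> (forall t, level (th t) (th1 t) = E) ->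
  (forall t, a t = D * th t ^ 2 - K) -> 0 < D <= B -> 0 < K -> 0 < E ->
  (4 * A + K) * K <= D * E -> 36 * B * K ^ 2 <= D ^ 2 * E ->
  zero_stable a.
Proof.
  intros H HE Ha HD HK HE0 HE1 HE2 t0 eps Heps.
  destruct (duffing_quarter_period th th1 t0 E H HE HE0)
    as [ph [ph1 [s0 [s1 [Hph [Hsq [Hlev [Hs0 [Hs1 [Hz [Hz1 Hpos]]]]]]]]]]].
  assert (Ha' : forall t, a t = D * ph t ^ 2 - K) by (intros; now rewrite Ha, Hsq).
  assert (Hc : forall t, continuous a t).
  { intros t. apply (continuous_ext (fun t => D * ph t ^ 2 - K)).
    - intros; symmetry; apply Ha'.
    - pose proof (proj1 (Hph t)) as H1.
      eapply (is_derive_continuous (fun t => D * ph t ^ 2 - K)). derive. reflexivity. }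
  assert (HM : forall t, Rabs (a t) <= 1 + 4 * B * E + K).
  { intros t. rewrite Ha'. pose proof (level_sq_bound _ _ _ (Hlev t)).
    assert (0 <= D * ph t ^ 2 <= B * ph t ^ 2) by (generalize (pow2_ge_0 (ph t)); nra).
    apply Rabs_le_between. split; nra. }
  assert (Hlt : forall t, a t < A + B * ph t ^ 2).
  { intros t. rewrite Ha'. generalize (pow2_ge_0 (ph t)). nra. }
  assert (Heven : forall t, a (2 * s1 - t) = a t).
  { intros t. rewrite !Ha'. now rewrite (duffing_even ph ph1 s1 t). }
  assert (Hper : forall t, a (t + 2 * (s1 - s0)) = a t).
  { intros t. rewrite !Ha'.
    (* The translation is the composite of the reflections about [s0] and [s1]; it changes the sign
       of [ph] but not [ph^2], so this is a period of [a]. *)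
    replace (t + 2 * (s1 - s0)) with (2 * s1 - (2 * s0 - t)) by ring.
    rewrite (duffing_even ph ph1 s1) by auto.
    rewrite (duffing_odd ph ph1 s0) by auto. ring. }
  destruct (linear_sol_exists a _ s0 1 0 Hc HM) as [c [c1 [Hcs [C0 C1]]]].
  destruct (linear_sol_exists a _ s0 0 1 Hc HM) as [s [s' [Hss [S0 S1]]]].
  assert (P1 : 0 < c s1) by (apply (cosine_pos a ph ph1 s0 s1) with (c1 := c1); auto; lra).
  assert (P2 : c1 s1 < 0)
    by (apply (cosine_derive_neg a ph ph1 s0 s1) with (c := c) (D := D) (K := K) (E := E);
        auto; lra).
  assert (P3 : forall t, s0 <= t <= s1 -> 0 < s' t)
    by (intros; apply (sine_monotone a ph ph1 s0 s1) with (s := s); auto).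
  assert (P4 : 0 < s s1).
  { rewrite <- S0. apply (derive_pos_lt s s'); auto; [intros; apply Hss|].
    intros; apply P3; lra. }
  specialize (P3 s1 ltac:(lra)).
  destruct (stable_of_invariant_form a _ (2 * (s1 - s0)) t0 s0
              (- (c s1 * c1 s1)) (s s1 * s' s1) HM Hper) with (eps := eps)
    as [d [Hd Hst]]; auto; try nra.
  - intros f f1 Hf. now apply (monodromy_invariant a c c1 s s' f f1 s0 s1).
  - exists d. split; auto. intros xi Hxi. apply Hst. now apply linear_sol_of_hill.
Qed.

End Duffing.

(** * Energy thresholds and conclusion *)

Theorem theorem13 (m n : nat) (P : R)
    (hm : (1 <= m)%nat) (hn : (1 <= n)%nat)
    (hP : INR n ^ 2 < P <= INR m ^ 2) :
  exists E1 E2 : R,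
    0 < E1 /\ E1 <= E2 /\
    (forall Theta : R -> R, duffing_solution m P Theta ->
       0 < energy m P Theta < E1 -> linearly_unstable m n P Theta) /\
    (forall Theta : R -> R, duffing_solution m P Theta ->
       energy m P Theta > E2 -> linearly_stable m n P Theta).
Proof.
  apply le_INR in hm, hn. simpl in hm, hn.
  set (A := INR m ^ 2 * (INR m ^ 2 - P)). set (B := INR m ^ 4).
  set (p := P - INR n ^ 2). set (K := INR n ^ 2 * p).
  set (D := INR m ^ 2 * INR n ^ 2).
  assert (Hm2 : 1 <= INR m ^ 2) by nra.
  assert (Hn2 : 1 <= INR n ^ 2) by nra.
  assert (Hp : 0 < p) by (unfold p; lra).
  assert (HA : 0 <= A) by (unfold A; nra).
  assert (HB : 0 < B) by (unfold B; replace (INR m ^ 4) with (INR m ^ 2 * INR m ^ 2) by ring; nra).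
  assert (HD : 0 < D <= B)
    by (unfold D, B; replace (INR m ^ 4) with (INR m ^ 2 * INR m ^ 2) by ring; nra).
  assert (HK : 0 < K) by (unfold K; nra).
  assert (Hflow : forall Theta, duffing_solution m P Theta ->
            duffing_flow A B Theta (Derive Theta)).
  { intros Theta [Hd He]. apply linear_sol_of_hill. split; auto.
    intros t. rewrite <- (He t). unfold A, B. ring. }
  assert (Hlev : forall Theta, duffing_solution m P Theta -> forall t,
            level A B (Theta t) (Derive Theta t) = energy m P Theta).
  { intros Theta HT t. rewrite (level_const A B Theta _ 0 t (Hflow _ HT)).
    reflexivity. }
  assert (Ha : forall Theta t, hill_coefficient m n P Theta t = D * Theta t ^ 2 - K).
  { intros. unfold hill_coefficient, D, K, p. ring. }
  (* Below [p^2 / 4], [B * Theta^4 <= 4 * E] gives [m^2 * Theta^2 <= p], that is, a nonpositive Hill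
     coefficient. In the second witness [36 * p^2] and [(4 * A + K) * p] serve the two conditions of
     [hill_stable], and [p^2 / 4] ensures [E1 <= E2]. *)
  exists (p ^ 2 / 4), (36 * p ^ 2 + p ^ 2 / 4 + (4 * A + K) * p).
  assert (Hp2 : 0 < p ^ 2) by nra.
  assert (HAKp : 0 <= (4 * A + K) * p) by (apply Rmult_le_pos; lra).
  split; [lra|]. split; [lra|]. split; intros Theta HT HE.
  - specialize (Hflow Theta HT). specialize (Hlev Theta HT).
    set (E := energy m P Theta) in *.
    assert (Hneg : forall t, 0 <= D * Theta t ^ 2 <= K).
    { intros t. pose proof (level_bound A B HA _ _ _ (Hlev t)) as Hb.
      pose proof (pow2_ge_0 (Theta t)) as Hx. split; [nra|].
      assert (INR m ^ 2 * Theta t ^ 2 <= p).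
      { apply Rsqr_incr_0_var; [|lra]. unfold Rsqr.
        replace (INR m ^ 2 * Theta t ^ 2 * (INR m ^ 2 * Theta t ^ 2))
          with (B * Theta t ^ 4) by (unfold B; ring). nra. }
      unfold D, K. nra. }
    apply (not_zero_stable_of_nonpos _ K).
    + intros t. apply (continuous_ext (fun t => D * Theta t ^ 2 - K)).
      * intros; symmetry; apply Ha.
      * pose proof (proj1 (Hflow t)) as H1.
        eapply (is_derive_continuous (fun t => D * Theta t ^ 2 - K)). derive. reflexivity.
    + intros t. rewrite Ha. specialize (Hneg t). apply Rabs_le_between. lra.
    + intros t. rewrite Ha. specialize (Hneg t). lra.
  - apply (hill_stable A B HA HB _ Theta (Derive Theta) D K (energy m P Theta)); auto.
    + lra.
    + set (E := energy m P Theta) in *.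
      (* The factor [n^2] cancels from both sides, and the [m^2] left in [D] is at least 1. *)
      replace ((4 * A + K) * K) with (INR n ^ 2 * ((4 * A + K) * p)) by (unfold K; ring).
      unfold D. rewrite (Rmult_comm (INR m ^ 2)), Rmult_assoc.
      apply Rmult_le_compat_l; [lra|]. nra.
    + set (E := energy m P Theta) in *.
      replace (36 * B * K ^ 2) with (D ^ 2 * (36 * p ^ 2)) by (unfold B, D, K; ring).
      apply Rmult_le_compat_l; [apply pow2_ge_0|]. lra.
Qed.
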